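(* Let $f(x) = \sum_{i=0}^\infty a_i x^i$ be a power series with real coefficients which converges absolutely on $[0,1]$. If there exists an $\varepsilon>0$ such that $\frac{|a_{i+1}|}{|a_i|}>\varepsilon$ for all but finitely many $i\in\mathbb{N}$, then $\operatorname{int} f[K]\neq\emptyset$ for the typical compact set $K\in\mathcal{K}([0,1])$; that is, the set of those $K\in\mathcal{K}([0,1])$ for which $f[K]$ has empty interior in $\mathbb{R}$ is meager in $\mathcal{K}([0,1])$.
   Context: $\mathcal{K}([0,1])$ is the space of nonempty compact subsets of $[0,1]$ with the Hausdorff metric. A property holds for the typical compact set $K\in\mathcal{K}([0,1])$ if the set of $K\in\mathcal{K}([0,1])$ not satisfying it is meager in $\mathcal{K}([0,1])$. For $A,B\subseteq\mathbb{R}$ and $c\in\mathbb{R}$, $A+B=\{a+b: a\in A, b\in B\}$ (Minkowski sum) and $cA=\{ca: a\in A\}$. For $A\subseteq\mathbb{R}$ and $n\in\mathbb{N}$ (including $n=0$), $[A]^{n}=\{\prod_{j=0}^{n-1}\alpha_j : \alpha_j\in A \text{ for } 0\le j<n\}$ is the $n$-fold Minkowski product of $A$ with itself, with $[A]^{0}=\{1\}$. For nonempty compact $K\subseteq[0,1]$ and a power series $f(x)=\sum_{i=0}^\infty a_i x^i$ absolutely convergent on $[0,1]$, $f[K]=\sum_{i=0}^\infty a_i [K]^{i}$, i.e. the limit with respect to the Hausdorff metric of the partial Minkowski sums $\sum_{i=0}^{n} a_i[K]^{i}$. $\operatorname{int}$ denotes interior in $\mathbb{R}$. *)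

(* Defs.v *)
From HB Require Import structures.
From mathcomp Require Import all_boot all_order all_algebra.
From mathcomp Require Import all_classical all_reals all_analysis.
From mathcomp Require Import ring.
Set Implicit Arguments.
Unset Strict Implicit.
Unset Printing Implicit Defensive.
Import Order.TTheory GRing.Theory Num.Theory.
Import numFieldNormedType.Exports.
Local Open Scope classical_set_scope.
Local Open Scope ring_scope.

Definition nowhere_dense (T : topologicalType) (A : set T) : Prop :=
  (closure A)° = set0.

Definition meager (T : topologicalType) (A : set T) : Prop :=
  exists F : nat -> set T,
    (forall n, nowhere_dense (F n)) /\ A = \bigcup_n F n.

Definition typical (T : topologicalType) (P : T -> Prop) : Prop :=
  meager [set x | ~ P x].

Definition dist_to_set (R : realType) (x : R) (A : set R) : R :=
  inf [set `|x - y| | y in A].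

Definition hausdorff_dist (R : realType) (A B : set R) : R :=
  Num.max (sup [set dist_to_set x B | x in A])
          (sup [set dist_to_set y A | y in B]).

Section hausdorff_dist_theory.
Context {R : realType}.
Implicit Types A B C : set R.

Let dist_set_has_inf (x : R) A : A !=set0 -> has_inf [set `|x - y| | y in A].
Proof.
move=> [a Aa]; split; first by exists `|x - a|, a.
by exists 0 => _ [y _ <-].
Qed.

Lemma dist_to_set_ge0 (x : R) A : A !=set0 -> 0 <= dist_to_set x A.
Proof.
by move=> [a Aa]; apply: lb_le_inf; [exists `|x - a|, a|move=> _ [y _ <-]].
Qed.

Lemma dist_to_set_le (x : R) A y : A y -> dist_to_set x A <= `|x - y|.
Proof.
move=> Ay; have [_ lbA] := dist_set_has_inf x (ex_intro _ y Ay).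
by apply: (ge_inf lbA); exists y.
Qed.

Lemma hausdorff_dist_le A B r : A !=set0 -> B !=set0 ->
  (forall x, A x -> exists2 y, B y & `|x - y| <= r) ->
  (forall y, B y -> exists2 x, A x & `|x - y| <= r) ->
  hausdorff_dist A B <= r.
Proof.
move=> [a Aa] [b Bb] AB BA; rewrite /hausdorff_dist ge_max; apply/andP; split.
- apply: ge_sup; first by exists (dist_to_set a B), a.
  move=> _ [x Ax <-]; have [y By xy] := AB _ Ax.
  exact: le_trans (dist_to_set_le _ By) xy.
- apply: ge_sup; first by exists (dist_to_set b A), b.
  move=> _ [y By <-]; have [x Ax xy] := BA _ By.
  by apply: le_trans (dist_to_set_le _ Ax) _; rewrite distrC.
Qed.

Lemma hausdorff_distC A B : hausdorff_dist A B = hausdorff_dist B A.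
Proof. exact: maxC. Qed.

Let dist_set_has_sup A B : A !=set0 -> compact A -> B !=set0 ->
  has_sup [set dist_to_set x B | x in A].
Proof.
move=> [a Aa] cA [b Bb]; split; first by exists (dist_to_set a B), a.
have [M [_ MA]] := compact_bounded cA.
exists (M + 1 + `|b|) => _ [x Ax <-].
apply: le_trans (dist_to_set_le _ Bb) _.
apply: le_trans (ler_normB _ _) _; rewrite lerD2r.
by apply: (MA (M + 1)) => //; rewrite ltrDl.
Qed.

Lemma hausdorff_dist_ge0 A B : A !=set0 -> compact A -> B !=set0 ->
  0 <= hausdorff_dist A B.
Proof.
move=> A0 cA B0; rewrite /hausdorff_dist le_max; apply/orP; left.
have [_ ub] := dist_set_has_sup A0 cA B0; have [a Aa] := A0.
by apply: le_trans (dist_to_set_ge0 a B0) _; apply: (ub_le_sup ub); exists a.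
Qed.

Lemma hausdorff_dist_lt A B r : compact A -> B !=set0 ->
  hausdorff_dist A B < r -> forall x, A x -> exists2 y, B y & `|x - y| < r.
Proof.
move=> cA B0; rewrite /hausdorff_dist gt_max => /andP[ABr _] x Ax.
have [_ ub] := dist_set_has_sup (ex_intro _ x Ax) cA B0.
have xr : dist_to_set x B < r.
  by apply: le_lt_trans ABr; apply: (ub_le_sup ub); exists x.
have [b Bb] := B0.
have [|_ [y By <-] ?] := inf_lt _ xr; first by exists `|x - b|, b.
by exists y.
Qed.

End hausdorff_dist_theory.

(* The hyperspace K(X) of nonempty compact subsets of X. *)
Record compacts (R : realType) (X : set R) := Compacts {
  compact_carrier :> set R;
  compact_carrier_sub : compact_carrier `<=` X;
  compact_carrier_neq0 : compact_carrier !=set0;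
  compact_carrier_compact : compact compact_carrier
}.

Section compacts_metric.
Context {R : realType} (X : set R).
Implicit Types K L M : compacts X.

HB.instance Definition _ := gen_eqMixin (compacts X).
HB.instance Definition _ := gen_choiceMixin (compacts X).

Lemma compacts_inj K L : K = L :> set R -> K = L.
Proof.
case: K L => [A A1 A2 A3] [B B1 B2 B3] /= AB; subst B.
by congr Compacts; exact: Prop_irrelevance.
Qed.

Let hdist K L : R := hausdorff_dist K L.

Let hdist_le_sub K L : hdist K L = 0 -> (K : set R) `<=` L.
Proof.
move=> KL x Kx; have cL := @compact_carrier_compact _ _ L.
apply: (compact_closed (@Rhausdorff R) cL) => B /nbhs_ballP[e /= e0 eB].
have KLe : hausdorff_dist K L < e by rewrite -/(hdist K L) KL.
have [y Ly xy] := hausdorff_dist_lt (@compact_carrier_compact _ _ K)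
  (@compact_carrier_neq0 _ _ L) KLe Kx.
by exists y; split => //; exact: eB.
Qed.

Let hdistxx K : hdist K K = 0.
Proof.
have K0 := @compact_carrier_neq0 _ _ K.
apply/eqP; rewrite eq_le hausdorff_dist_ge0 ?andbT//; last first.
  exact: compact_carrier_compact.
by apply: hausdorff_dist_le => // x Kx; exists x; rewrite // subrr normr0.
Qed.

Let hdistC K L : hdist K L = hdist L K.
Proof. exact: hausdorff_distC. Qed.

Let hdist_positivity K L : hdist K L = 0 -> K = L.
Proof.
move=> KL; apply/compacts_inj/seteqP; split; first exact: hdist_le_sub.
by apply: hdist_le_sub; rewrite hdistC.
Qed.

Let hdist_triangle L K M : hdist K M <= hdist K L + hdist L M.
Proof.
have c (N : compacts X) := @compact_carrier_compact _ _ N.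
have n0 (N : compacts X) := @compact_carrier_neq0 _ _ N.
suff tri (K' L' M' : compacts X) (e : R) : 0 < e -> forall x, (K' : set R) x ->
    exists2 y, (M' : set R) y & `|x - y| <= hdist K' L' + hdist L' M' + e.
  apply/ler_addgt0Pr => e e0; apply: hausdorff_dist_le => // [x Kx|y My].
    exact: tri.
  have [x Kx xy] := tri M L K e e0 _ My; exists x => //.
  by rewrite distrC (hdistC K L) (hdistC L M) (addrC (hdist L K)).
move=> e0 x Kx; have e20 : 0 < e / 2 by rewrite divr_gt0.
have [|y Ly xy] := hausdorff_dist_lt (r := hdist K' L' + e / 2) (c K') (n0 L') _ Kx.
  by rewrite ltrDl.
have [|z Mz yz] := hausdorff_dist_lt (r := hdist L' M' + e / 2) (c L') (n0 M') _ Ly.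
  by rewrite ltrDl.
exists z => //; apply: le_trans (ler_distD y _ _) _.
rewrite [in leRHS](splitr e) addrACA.
by apply: lerD; exact: ltW.
Qed.

HB.instance Definition _ := @isMetric.Build R (compacts X) hdist
  hdistxx hdist_positivity hdistC hdist_triangle.

End compacts_metric.

Section compacts_pointed.
Context {R : realType}.

Definition compacts_point : compacts [set: R] :=
  @Compacts R setT [set 0] (@subsetT _ _) (ex_intro _ 0 erefl) (@compact_set1 _ 0).

HB.instance Definition _ := isPointed.Build (compacts [set: R]) compacts_point.

End compacts_pointed.

Section minkowski.
Context {R : realType}.
Implicit Types (A B : set R) (c : R) (n : nat) (a : nat -> R).

Definition minkowski_sum A B : set R := [set x + y | x in A & y in B].

Definition minkowski_scale c A : set R := [set c * x | x in A].

Definition minkowski_power A n : set R :=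
  [set \prod_(j < n) alpha j
    | alpha in [set alpha : 'I_n -> R | forall j, A (alpha j)]].

Definition power_partial_sum a A n : set R :=
  \big[minkowski_sum/[set 0]]_(i < n.+1)
    minkowski_scale (a i) (minkowski_power A i).

Lemma minkowski_sumC : commutative minkowski_sum.
Proof.
suff sub A B : minkowski_sum A B `<=` minkowski_sum B A.
  by move=> A B; apply/seteqP; split; exact: sub.
by move=> _ [x Ax [y By <-]]; exists y => //; exists x => //; rewrite addrC.
Qed.

Lemma minkowski_sum0 : left_id [set 0] minkowski_sum.
Proof.
move=> A; apply/seteqP; split => [_ [_ -> [y Ay <-]]|x Ax]; first by rewrite add0r.
by exists 0 => //; exists x => //; rewrite add0r.
Qed.

Lemma minkowski_sumA : associative minkowski_sum.
Proof.
move=> A B C; apply/seteqP; split.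
- move=> _ [x Ax [_ [y By [z Cz <-]] <-]].
  by exists (x + y); [exists x => //; exists y|exists z; rewrite ?addrA].
- move=> _ [_ [x Ax [y By <-]] [z Cz <-]].
  by exists x => //; exists (y + z); [exists y => //; exists z|rewrite addrA].
Qed.

HB.instance Definition _ := Monoid.isComLaw.Build (set R) [set 0] minkowski_sum
  minkowski_sumA minkowski_sumC minkowski_sum0.

Lemma minkowski_power0 A : minkowski_power A 0 = [set 1].
Proof.
apply/seteqP; split => [_ [alpha _ <-]|_ ->]; first by rewrite big_ord0.
by exists (fun=> 1); [case|rewrite big_ord0].
Qed.

Lemma minkowski_powerS A n : minkowski_power A n.+1 =
  [set x * y | x in A & y in minkowski_power A n].
Proof.
apply/seteqP; split.
- move=> _ [alpha Aalpha <-]; exists (alpha ord0) => //.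
  exists (\prod_(j < n) alpha (lift ord0 j)); last by rewrite big_ord_recl.
  by exists (fun j => alpha (lift ord0 j)).
- move=> _ [x Ax [_ [alpha Aalpha <-] <-]].
  exists (fun j => oapp alpha x (unlift ord0 j)).
    by move=> j /=; case: unlift.
  rewrite big_ord_recl unlift_none /=; congr (_ * _).
  by apply: eq_bigr => j _; rewrite liftK.
Qed.

Lemma compact_minkowski_sum A B :
  compact A -> compact B -> compact (minkowski_sum A B).
Proof.
move=> cA cB.
have -> : minkowski_sum A B = (fun z : R * R => z.1 + z.2) @` (A `*` B).
  apply/seteqP; split => [_ [x Ax [y By <-]]|_ [[x y] [/= Ax By] <-]].
    by exists (x, y).
  by exists x => //; exists y.
apply: continuous_compact (compact_setX cA cB).
by apply: continuous_subspaceT => z; apply: cvgD; [exact: cvg_fst|exact: cvg_snd].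
Qed.

Lemma compact_minkowski_scale c A : compact A -> compact (minkowski_scale c A).
Proof.
move=> cA; apply: continuous_compact cA.
by apply: continuous_subspaceT; exact: mulrl_continuous.
Qed.

Lemma compact_minkowski_power A n : compact A -> compact (minkowski_power A n).
Proof.
move=> cA; elim: n => [|n IHn].
  by rewrite minkowski_power0; exact: compact_set1.
rewrite minkowski_powerS.
have -> : [set x * y | x in A & y in minkowski_power A n] =
    (fun z : R * R => z.1 * z.2) @` (A `*` minkowski_power A n).
  apply/seteqP; split => [_ [x Ax [y By <-]]|_ [[x y] [/= Ax By] <-]].
    by exists (x, y).
  by exists x => //; exists y.
apply: continuous_compact (compact_setX cA IHn).
by apply: continuous_subspaceT => z; apply: cvgM; [exact: cvg_fst|exact: cvg_snd].
Qed.

Lemma power_partial_sumS a A n : power_partial_sum a A n.+1 =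
  minkowski_sum (power_partial_sum a A n)
    (minkowski_scale (a n.+1) (minkowski_power A n.+1)).
Proof. by rewrite /power_partial_sum big_ord_recr. Qed.

Lemma power_partial_sum0 a A :
  power_partial_sum a A 0 = minkowski_scale (a 0) [set 1].
Proof.
by rewrite /power_partial_sum big_ord_recr big_ord0 /= minkowski_sum0
  minkowski_power0.
Qed.

Lemma compact_power_partial_sum a A n :
  compact A -> compact (power_partial_sum a A n).
Proof.
move=> cA; elim: n => [|n IHn].
  by rewrite power_partial_sum0; exact/compact_minkowski_scale/compact_set1.
rewrite power_partial_sumS; apply: compact_minkowski_sum => //.
exact/compact_minkowski_scale/compact_minkowski_power.
Qed.

Lemma minkowski_power_exp A n x : A x -> minkowski_power A n (x ^+ n).
Proof.
by move=> Ax; exists (fun=> x) => //; rewrite prodr_const card_ord.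
Qed.

Lemma power_partial_sum_series a A n x : A x ->
  power_partial_sum a A n (series (fun i => a i * x ^+ i) n.+1).
Proof.
move=> Ax; elim: n => [|n IHn].
  rewrite power_partial_sum0 seriesEnat /= big_nat1 expr0.
  by exists 1.
rewrite power_partial_sumS seriesEnat /= big_nat_recr //=.
exists (series (fun i => a i * x ^+ i) n.+1) => //.
exists (a n.+1 * x ^+ n.+1); last by rewrite seriesEnat.
by exists (x ^+ n.+1) => //; exact: minkowski_power_exp.
Qed.

Lemma power_partial_sum_neq0 a A n :
  A !=set0 -> power_partial_sum a A n !=set0.
Proof.
case=> x Ax; exists (series (fun i => a i * x ^+ i) n.+1).
exact: power_partial_sum_series.
Qed.

End minkowski.

Section power_series_image.
Context {R : realType}.
Implicit Types (a : nat -> R) (K : compacts (`[0, 1] : set R)).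

Definition compact_partial_sum a K (n : nat) : compacts [set: R] :=
  @Compacts R setT (power_partial_sum a K n) (@subsetT _ _)
    (@power_partial_sum_neq0 R a K n (@compact_carrier_neq0 _ _ K))
    (@compact_power_partial_sum R a K n (@compact_carrier_compact _ _ K)).

(* f[K], as a point of K(R); [compact_partial_sum_cvg] below shows that the
   limit exists as soon as the series of the coefficients converges absolutely. *)
Definition power_series_image a K : compacts [set: R] :=
  limn (compact_partial_sum a K).

End power_series_image.

Section power_series_image_cvg.
Context {R : realType} (a : nat -> R) (K : compacts (`[0, 1] : set R)).
Hypothesis acvg : cvgn [normed series a].

Let S n : set R := power_partial_sum a K n.
Let T : nat -> R := [normed series a].
Let t : R := limn T.

Let TE n : T n = \sum_(0 <= i < n) `|a i|.
Proof. by []. Qed.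

Let T_nd : nondecreasing_seq T.
Proof. by apply: nondecreasing_series => i _ _; exact: normr_ge0. Qed.

Let T_le n : T n <= t.
Proof. exact: nondecreasing_cvgn_le. Qed.

Let power_le1 n x : minkowski_power K n x -> `|x| <= 1.
Proof.
move=> [alpha Kalpha <-]; rewrite normr_prod.
have K01 j : 0 <= `|alpha j| <= 1.
  rewrite normr_ge0 /= ; have := compact_carrier_sub (Kalpha j).
  by rewrite /= in_itv /= => /andP[? ?]; rewrite ger0_norm.
by apply: Num.Theory.prodr_ile1 => j _.
Qed.

Let S_down n k y : S (n + k) y ->
  exists2 x, S n x & `|x - y| <= T (n + k).+1 - T n.+1.
Proof.
elim: k y => [|k IHk] y.
  by rewrite addn0 => Sy; exists y; rewrite // !subrr normr0.
rewrite addnS /S power_partial_sumS => -[z Sz [_ [p Kp <-] <-]].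
have [x Sx xz] := IHk _ Sz; exists x => //.
rewrite opprD addrA; apply: le_trans (ler_normB _ _) _.
rewrite (TE (n + k).+2) big_nat_recr //= -TE addrAC.
by apply: lerD => //; rewrite normrM ler_piMr // (power_le1 Kp).
Qed.

Let S_le n y : S n y -> `|y| <= t.
Proof.
move=> Sy; have := @S_down 0 n y; rewrite add0n => /(_ Sy)[x].
rewrite /S power_partial_sum0 => -[_ -> <-]; rewrite mulr1 => xy.
rewrite -[y](subKr (a 0)); apply: le_trans (ler_normB _ _) _.
apply: le_trans (T_le n.+1); rewrite addrC -lerBrDr.
by apply: le_trans xy _; rewrite lerD2l lerN2 TE big_nat1.
Qed.

Let L : set R := [set x | forall e, 0 < e ->
  \forall n \near \oo, exists2 y, S n y & `|x - y| < e].

Let S_up n x : S n x -> exists2 y, L y & `|x - y| <= t - T n.+1.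
Proof.
move=> Sx; have [k Kk] := @compact_carrier_neq0 _ _ K.
pose u i := a i * k ^+ i; pose s := series u.
have ua i : `|u i| <= `|a i|.
  by rewrite normrM ler_piMr // (@power_le1 i) //; exact: minkowski_power_exp.
have scvg : cvgn s.
  apply: normed_cvg; apply: series_le_cvg acvg => // i; exact: normr_ge0.
have Sxs m : S (n + m) (x - s n.+1 + s (n + m).+1).
  elim: m => [|m IHm]; first by rewrite addn0 subrK.
  rewrite addnS /S power_partial_sumS; exists (x - s n.+1 + s (n + m).+1) => //.
  exists (u (n + m).+1).
    by exists (k ^+ (n + m).+1) => //; exact: minkowski_power_exp.
  by rewrite -addrA; congr (_ + _); rewrite /s !seriesEnat /= [RHS]big_nat_recr.
exists (x - s n.+1 + limn s).
- move=> e e0; have := scvg => /cvgrPdist_lt /(_ e e0)[N _ sN].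
  exists (N + n)%N => // m /= Nm.
  have nm : (n <= m)%N by rewrite (leq_trans _ Nm) ?leq_addl.
  exists (x - s n.+1 + s m.+1); first by rewrite -(subnKC nm).
  rewrite opprD addrACA subrr add0r; apply: sN => /=.
  by rewrite (leq_trans _ (leqnSn _)) ?(leq_trans _ Nm) ?leq_addr.
- have -> : x - (x - s n.+1 + limn s) = - (limn s - s n.+1) by ring.
  rewrite normrN.
  have -> : limn s - s n.+1 = limn (fun m => s m - s n.+1).
    by apply/esym/cvg_lim => //; apply: cvgB => //; exact: cvg_cst.
  have sB : cvgn (fun m => s m - s n.+1) by apply: is_cvgB => //; exact: is_cvg_cst.
  rewrite -lim_norm //; apply: limr_le; first exact: is_cvg_norm.
  near=> m; have nm : (n.+1 <= m)%N by near: m; exact: nbhs_infty_ge.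
  apply: (@le_trans _ _ (T m - T n.+1)); last by rewrite lerD2r T_le.
  rewrite /s /T sub_series nm sub_series nm; apply: le_trans (ler_norm_sum _ _ _) _.
  by apply: ler_sum.
Unshelve. all: by end_near. Qed.

Let S_up_L x n e : L x -> 0 < e -> exists2 y, S n y & `|y - x| <= t - T n.+1 + e.
Proof.
move=> Lx e0; have [N _ LN] := Lx e e0.
have [|z Sz xz] := LN (n + N)%N; first by rewrite /= leq_addl.
have [y Sy yz] := S_down Sz; exists y => //.
apply: le_trans (ler_distD z _ _) _; apply: lerD; last by rewrite distrC ltW.
by apply: le_trans yz _; rewrite lerD2r.
Qed.

Let L_neq0 : L !=set0.
Proof.
have [x Sx] := power_partial_sum_neq0 a 0 (@compact_carrier_neq0 _ _ K).
by have [y Ly _] := S_up Sx; exists y.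
Qed.

Let L_compact : compact L.
Proof.
apply: (subclosed_compact _ (@segment_compact R (- (t + 1)) (t + 1))).
- move=> x Lx e e0; have e20 : 0 < e / 2 by rewrite divr_gt0.
  have [y [Ly]] := Lx _ (nbhsx_ballx x _ e20); rewrite /ball /= => xy.
  near=> n; have [z Sz yz] : exists2 z, S n z & `|y - z| < e / 2.
    by near: n; exact: Ly.
  exists z => //; rewrite (le_lt_trans (ler_distD y _ _)) //.
  by rewrite [ltRHS]splitr ltrD.
- move=> x Lx; have [N _ LN] := Lx 1 ltr01.
  have [|y Sy xy] := LN N; first by rewrite /=.
  rewrite /= in_itv /= -ler_norml -[x](subrK y).
  apply: le_trans (ler_normD _ _) _; rewrite addrC; apply: lerD (ltW xy).
  exact: S_le Sy.
Unshelve. all: by end_near. Qed.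

Lemma compact_partial_sum_cvg : cvgn (compact_partial_sum a K).
Proof.
apply/cvg_ex; exists (@Compacts R setT L (@subsetT _ _) L_neq0 L_compact).
apply/cvg_ballP => e e0; have e40 : 0 < e / 4 by rewrite divr_gt0.
have [N _ tN] := (cvgrPdist_lt _ _).1 acvg _ e40.
exists N => // n /= Nn; rewrite ballEmdist /=.
have tn : t - T n.+1 < e / 4.
  by apply: le_lt_trans (ler_norm _) _; apply: tN => /=; exact: leqW.
apply: (@le_lt_trans _ _ (e / 2)); last by rewrite ltr_pdivrMr // mulr2n mulrDr mulr1 ltrDl.
have e42 : t - T n.+1 + e / 4 <= e / 2.
  by rewrite [e / 2](_ : _ = e / 4 + e / 4) ?lerD2r ?ltW //; field.
apply: hausdorff_dist_le => //.
- exact: power_partial_sum_neq0 (@compact_carrier_neq0 _ _ K).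
- move=> x Lx; have [y Sy xy] := S_up_L n Lx e40.
  by exists y => //; rewrite distrC (le_trans xy).
- move=> y Sy; have [x Lx xy] := S_up Sy; exists x => //.
  by rewrite distrC (le_trans xy) // (le_trans _ e42) // lerDl ltW.
Qed.

End power_series_image_cvg.

(* Main.v *)
Require Import Defs.
From mathcomp Require Import all_boot all_order all_algebra.
From mathcomp Require Import all_classical all_reals all_analysis.
From mathcomp Require Import ring lra.
Import Order.TTheory GRing.Theory Num.Theory.
Import numFieldNormedType.Exports.
Local Open Scope classical_set_scope.
Local Open Scope ring_scope.

(** Suppose that [K] contains points [x < y] with [y - x <= eps / 2 * y ^+ 2].
    Then [[K]^n] contains the geometric chain [x^(n-j) y^j], [j <= n], which runs
    from [x^n] to [y^n] in steps of at most [y^(n-1) (y - x)], while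
    [[K]^(n+1)] contains two points at distance [y^(n+1) - x^(n+1)], and this is
    at least [y^(n+1) / 2] once [n] is large. Since [|a_(n+1)|] exceeds
    [eps |a_n|], the gaps of the chain in [a_n [K]^n] are therefore at most the
    distance [D_(n+1)] between the ends of the chain in [a_(n+1) [K]^(n+1)].

    This is the situation of Kakeya's theorem on subsums, with finite sets in
    place of pairs, and a greedy expansion works: a remainder in [[0, D_n]] is
    approximated from below by a point of the [n]-th chain, measured from its
    lower end, and what is left lies in [[0, D_(n+1)]] ([greedy_step],
    [greedy_expansion]). As [D_n <= |a_n|] tends to [0], the image [f[K]]
    contains a translate of [[0, D_M]] for some [M] ([subset_power_series_image]),
    which is a nondegenerate interval ([power_series_image_interior]).

    Having two such points is typical. Meeting a given open set is an open
    condition on [K] ([open_meets]), so prescribing two adjacent small intervals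
    that [K] must meet gives an open family ([open_close_pair]); it is dense
    because adding two points that are close to each other and close to [K]
    moves [K] only slightly ([dense_close_pair]). *)

(** * Points of Minkowski powers and partial sums *)

Lemma minkowski_power_expM (R : realType) (A : set R) (u w : R) (m n : nat) :
  A u -> A w -> minkowski_power A (m + n) (u ^+ m * w ^+ n).
Proof.
move=> Au Aw; elim: m => [|m IHm].
  by rewrite mul1r; exact: minkowski_power_exp.
rewrite addSn minkowski_powerS; exists u => //.
by exists (u ^+ m * w ^+ n) => //; rewrite exprS mulrA.
Qed.

(** The points [p i] may be chosen independently for each [i]; below, the base
    of the power depends on the sign of [a i]. *)
Lemma series_mem_power_partial_sum (R : realType) (a p : nat -> R) (A : set R)
    (n : nat) : (forall i, minkowski_power A i (p i)) ->
  power_partial_sum a A n (series (fun i => a i * p i) n.+1).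
Proof.
move=> Ap; elim: n => [|n IHn].
  rewrite power_partial_sum0 seriesEnat /= big_nat1.
  by exists (p 0) => //; rewrite -(minkowski_power0 A).
rewrite power_partial_sumS seriesEnat /= big_nat_recr //=.
exists (series (fun i => a i * p i) n.+1) => //.
by exists (a n.+1 * p n.+1); [exists (p n.+1)|rewrite seriesEnat].
Qed.

(** The image is closed, being compact, so a real number that is approximated by
    points of the partial sums belongs to it; the existence of the limit
    defining the image is what absolute convergence provides. *)
Lemma mem_power_series_image (R : realType) (a : nat -> R)
    (K : compacts (`[0, 1] : set R)) (z : R) :
  cvgn [normed series a] ->
  (forall e, 0 < e -> \forall n \near \oo,
     exists2 q, power_partial_sum a K n q & `|z - q| < e) ->
  (power_series_image a K : set R) z.
Proof.
move=> acvg zS; set L := power_series_image a K.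
have cL := @compact_carrier_compact _ _ L.
apply: (compact_closed (@Rhausdorff R) cL) => B /nbhs_ballP[e /= e0 eB].
have e20 : 0 < e / 2 by rewrite divr_gt0.
have /cvg_ballP/(_ _ e20) SL := compact_partial_sum_cvg (K := K) acvg.
have [n [SLn [q Sq zq]]] := filter_ex (filterI SL (zS _ e20)).
move: SLn; rewrite ballEmdist /= => SLn.
have {}SLn : hausdorff_dist (power_partial_sum a K n) L < e / 2.
  by rewrite hausdorff_distC.
have [w Lw qw] := hausdorff_dist_lt
  (@compact_carrier_compact _ _ (compact_partial_sum a K n))
  (@compact_carrier_neq0 _ _ L) SLn Sq.
exists w; split => //; apply: eB; rewrite /ball /=.
rewrite (le_lt_trans (ler_distD q _ _)) //.
by rewrite [ltRHS]splitr ltrD.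
Qed.

(** * Greedy expansions *)

Lemma discrete_ivt (R : realDomainType) (v : nat -> R) (n : nat) (t g : R) :
  v 0%N <= t <= v n -> 0 <= g ->
  (forall j, (j < n)%N -> v j.+1 <= v j + g) ->
  exists2 j, (j <= n)%N & v j <= t <= v j + g.
Proof.
move=> + g0; elim: n => [|n IHn] /andP[v0t tvn] vg.
  by exists 0%N => //; rewrite v0t (le_trans tvn) // lerDl.
have [tn|nt] := leP t (v n).
  have [||j jn vj] := IHn; first by rewrite v0t.
    by move=> j jn; apply: vg; exact: ltnW.
  by exists j => //; exact: leqW.
by exists n => //; rewrite ltW //= (le_trans tvn) // vg.
Qed.

(** Consecutive terms of the chain [a u^(n+1-j) w^j] differ by
    [a u^(n-j) w^j (w - u)], and [u] and [w] are bounded by [y]. The order of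
    [u] and [w] is left open, since multiplication by a negative [a] reverses
    the chain. *)
Lemma geometric_mesh (R : realFieldType) (a u w y t : R) (n : nat) :
  0 <= u <= y -> 0 <= w <= y -> a * u ^+ n.+1 <= t <= a * w ^+ n.+1 ->
  exists2 j, (j <= n.+1)%N & let p := a * (u ^+ (n.+1 - j) * w ^+ j) in
    p <= t <= p + `|a| * y ^+ n * `|w - u|.
Proof.
move=> /andP[u0 uy] /andP[w0 wy] tuw.
apply: (@discrete_ivt _ (fun j => a * (u ^+ (n.+1 - j) * w ^+ j))).
- by rewrite subn0 subnn !expr0 mul1r mulr1.
- by rewrite !mulr_ge0 ?exprn_ge0 // (le_trans u0).
- move=> j; rewrite ltnS => jn; rewrite subSS subSn // -lerBlDl.
  have -> : a * (u ^+ (n - j) * w ^+ j.+1) - a * (u ^+ (n - j).+1 * w ^+ j) =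
      a * (u ^+ (n - j) * w ^+ j) * (w - u) by rewrite !exprS; ring.
  apply: le_trans (ler_norm _) _; rewrite normrM ler_wpM2r // normrM ler_wpM2l //.
  rewrite ger0_norm ?mulr_ge0 ?exprn_ge0 // -[in leRHS](subnK jn) exprD.
  by apply: ler_pM; rewrite ?exprn_ge0 // lerXn2r // nnegrE // (le_trans u0).
Qed.

(** The base for which [a i * low_base ^+ i] is the lower end of the chain
    between [a i * x ^+ i] and [a i * y ^+ i]. *)
Definition low_base {R : realType} (a : nat -> R) (x y : R) (i : nat) : R :=
  if 0 <= a i then x else y.

Definition low_term {R : realType} (a : nat -> R) (x y : R) (i : nat) : R :=
  a i * low_base a x y i ^+ i.

Definition spread {R : realType} (a : nat -> R) (x y : R) (i : nat) : R :=
  `|a i| * (y ^+ i - x ^+ i).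

(** One step of the expansion: [r] is the current remainder, and
    [a n.+1 * p - low_term n.+1] is the part of it that is absorbed. *)
Lemma greedy_step (R : realType) (a : nat -> R) (A : set R) (x y r : R)
    (n : nat) : A x -> A y -> 0 <= x <= y -> 0 <= r <= spread a x y n.+1 ->
  exists2 p, minkowski_power A n.+1 p &
    a n.+1 * p <= low_term a x y n.+1 + r <=
    a n.+1 * p + `|a n.+1| * y ^+ n * (y - x).
Proof.
move=> Ax Ay /andP[x0 xy] /andP[r0]; rewrite /low_term /low_base /spread => rD.
have y0 := le_trans x0 xy.
have mem u w j : A u -> A w -> (j <= n.+1)%N ->
    minkowski_power A n.+1 (u ^+ (n.+1 - j) * w ^+ j).
  by move=> Au Aw jn; rewrite -[in minkowski_power A n.+1](subnK jn);
     exact: minkowski_power_expM.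
have [a0|a0] := leP 0 (a n.+1).
- move: rD; rewrite (ger0_norm a0) => rD.
  have [|||j jn] := @geometric_mesh _ (a n.+1) x y y (a n.+1 * x ^+ n.+1 + r) n.
  + by rewrite x0.
  + by rewrite y0 lexx.
  + rewrite lerDl r0 /=; lra.
  + rewrite (ger0_norm a0) ger0_norm ?subr_ge0 // => jP.
    by exists (x ^+ (n.+1 - j) * y ^+ j) => //; exact: mem.
- move: rD; rewrite (ltr0_norm a0) => rD.
  have [|||j jn] := @geometric_mesh _ (a n.+1) y x y (a n.+1 * y ^+ n.+1 + r) n.
  + by rewrite y0 lexx.
  + by rewrite x0.
  + rewrite lerDl r0 /=; lra.
  + rewrite (ltr0_norm a0) distrC ger0_norm ?subr_ge0 // => jP.
    by exists (y ^+ (n.+1 - j) * x ^+ j) => //; exact: mem.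
Qed.

(** The mesh hypothesis says that the gaps at index [n.+1] do not exceed the
    spread at index [n.+2]; it keeps the remainder within the spread of the next
    chain, so that the expansion can go on. Below [M.+1] the lower ends are
    chosen. *)
Lemma greedy_expansion (R : realType) (a : nat -> R) (A : set R) (x y t : R)
    (M : nat) : A x -> A y -> 0 <= x <= y ->
  (forall n, (M <= n)%N ->
     `|a n.+1| * y ^+ n * (y - x) <= spread a x y n.+2) ->
  0 <= t <= spread a x y M.+1 ->
  forall n, (M <= n)%N -> exists2 q, power_partial_sum a A n q &
    0 <= series (low_term a x y) n.+1 + t - q <= spread a x y n.+1.
Proof.
move=> Ax Ay xy mesh tD n /subnKC <-; elim: (n - M)%N => [|k [q Sq qr]].
  rewrite addn0; exists (series (low_term a x y) M.+1).
    apply: series_mem_power_partial_sum => i; apply: minkowski_power_exp.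
    by rewrite /low_base; case: ifP.
  by rewrite addrAC subrr add0r.
rewrite addnS; have [p Ap pr] := greedy_step R a A x y _ (M + k) Ax Ay xy qr.
exists (q + a (M + k).+1 * p).
  rewrite power_partial_sumS; exists q => //.
  by exists (a (M + k).+1 * p) => //; exists p.
have g := mesh (M + k)%N (leq_addr _ _).
move: pr qr; rewrite [series _ (M + k).+2]seriesSr.
move: (series _ _) => s; lra.
Qed.

(** * Intervals in the image of a set with two close points *)

(** All greedy expansions start from the same sum of lower ends, and the
    remainder is at most [spread n.+1 <= |a n.+1|], which tends to [0]. *)
Lemma subset_power_series_image (R : realType) (a : nat -> R)
    (K : compacts (`[0, 1] : set R)) (x y : R) (M : nat) :
  cvgn [normed series a] -> (K : set R) x -> (K : set R) y -> x <= y ->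
  (forall n, (M <= n)%N ->
     `|a n.+1| * y ^+ n * (y - x) <= spread a x y n.+2) ->
  [set limn (series (low_term a x y)) + t | t in `[0, spread a x y M.+1]] `<=`
  power_series_image a K.
Proof.
move=> acvg Kx Ky xy mesh _ [t + <-]; rewrite /= in_itv /= => tD.
have unit z : (K : set R) z -> 0 <= z <= 1.
  by move=> /compact_carrier_sub; rewrite /= in_itv.
have /andP[x0 x1] := unit _ Kx; have /andP[y0 y1] := unit _ Ky.
have lcvg : cvgn (series (low_term a x y)).
  apply: normed_cvg; apply: series_le_cvg acvg => i //=.
  rewrite /low_term /low_base normrM ler_piMr // normrX.
  by case: ifP => _; rewrite exprn_ile1 // ger0_norm.
have Dle i : spread a x y i <= `|a i|.
  rewrite ler_piMr // -[leRHS]subr0; apply: lerB; last exact: exprn_ge0.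
  exact: exprn_ile1.
have a0 : (fun i => `|a i|) @ \oo --> (0 : R) := cvg_series_cvg_0 acvg.
set l := limn _.
apply: mem_power_series_image => // e e0.
have e20 : 0 < e / 2 by rewrite divr_gt0.
near=> n.
have xy' : 0 <= x <= y by rewrite x0.
have Mn : (M <= n)%N by near: n; exact: nbhs_infty_ge.
have [q Sq qD] := greedy_expansion R a K x y t M Kx Ky xy' mesh tD n Mn.
exists q => //.
have ls : `|l - series (low_term a x y) n.+1| < e / 2.
  near: n; have : series (low_term a x y) i.+1 @[i --> \oo] --> l.
    by rewrite (cvg_shiftS (series (low_term a x y))).
  by move=> /cvgrPdist_lt; apply.
have an : `|a n.+1| < e / 2.
  near: n; have : (fun i => `|a i.+1|) @ \oo --> (0 : R).
    by rewrite (cvg_shiftS (fun i => `|a i|)).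
  move=> /cvgr0Pnorm_lt/(_ _ e20); apply: filterS => i.
  by rewrite normr_id.
move: (series _ _) ls qD => s ls qD.
have -> : l + t - q = (l - s) + (s + t - q) by ring.
rewrite (le_lt_trans (ler_normD _ _)) // [ltRHS]splitr ltrD //.
move: qD => /andP[q0 qD]; rewrite ger0_norm //.
by rewrite (le_lt_trans qD) // (le_lt_trans (Dle _)).
Unshelve. all: by end_near. Qed.

(** The constant [eps / 2] leaves a factor [2] to spare, which pays for replacing
    [y ^+ n - x ^+ n] by [y ^+ n / 2]. *)
Lemma power_series_image_interior (R : realType) (a : nat -> R) (eps : R)
    (N : nat) (K : compacts (`[0, 1] : set R)) (x y : R) :
  cvgn [normed series a] ->
  (forall i, (N <= i)%N -> eps < `|a i.+1| / `|a i|) -> 0 < eps ->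
  (K : set R) x -> (K : set R) y -> x < y -> y - x <= eps / 2 * y ^+ 2 ->
  (power_series_image a K : set R)° !=set0.
Proof.
move=> acvg aN eps0 Kx Ky xy close.
have x0 : 0 <= x.
  by have /andP[] : 0 <= x <= 1 by move: (compact_carrier_sub Kx); rewrite /= in_itv.
have y0 : 0 < y := le_lt_trans x0 xy.
have an0 i : (N <= i)%N -> 0 < `|a i|.
  move=> Ni; rewrite lt_neqAle normr_ge0 andbT eq_sym; apply/eqP => ai0.
  by have := aN _ Ni; rewrite ai0 invr0 mulr0 ltNge ltW.
(* The ratio x / y is below 1, so its powers eventually drop below 1 / 2. *)
have [P _ halfP] : \forall n \near \oo, x ^+ n <= y ^+ n / 2.
  have xy1 : `|x / y| < 1.
    by rewrite ger0_norm ?divr_ge0 // 1?ltW // ltr_pdivrMr // mul1r.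
  have h : (0 : R) < 2^-1 by rewrite invr_gt0.
  have /cvgr0Pnorm_lt/(_ _ h) := cvg_expr xy1.
  apply: filterS => n; rewrite ger0_norm; last by rewrite exprn_ge0 ?divr_ge0 // ltW.
  rewrite expr_div_n ltr_pdivrMr ?exprn_gt0 // => /ltW.
  by rewrite mulrC.
pose M := maxn N P.
have sub := @subset_power_series_image R a K x y M acvg Kx Ky (ltW xy).
set D := spread a x y M.+1 in sub.
have D0 : 0 < D.
  rewrite mulr_gt0 //; first by apply: an0; rewrite leqW // leq_maxl.
  by rewrite subr_gt0 ltr_pXn2r // nnegrE // ltW.
set c := limn _ in sub; exists (c + D / 2).
apply/nbhs_ballP; exists (D / 2) => [|z]; first by rewrite /= divr_gt0.
rewrite /ball /= ltr_distlC => /andP[z1 z2]; apply: sub; last first.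
  by exists (z - c); [rewrite /= in_itv /=; apply/andP; split; lra|rewrite addrC subrK].
move=> n; rewrite geq_max => /andP[Nn Pn].
have half : x ^+ n.+2 <= y ^+ n.+2 / 2.
  by apply: halfP => /=; rewrite (leq_trans Pn) // -addn2 leq_addr.
have an : eps * `|a n.+1| <= `|a n.+2|.
  by rewrite -ler_pdivlMr ?an0 ?leqW // ltW // aN // leqW.
have yn : 0 <= `|a n.+1| * y ^+ n by rewrite mulr_ge0 // exprn_ge0 // ltW.
apply: (le_trans (ler_wpM2l yn close)).
have -> : `|a n.+1| * y ^+ n * (eps / 2 * y ^+ 2) =
    (eps * `|a n.+1|) * (y ^+ n.+2 / 2) by rewrite !exprS expr0; field.
rewrite /spread; apply: ler_pM => //.
- by rewrite mulr_ge0 // ltW.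
- by rewrite divr_ge0 // exprn_ge0 // ltW.
- lra.
Qed.

(** * Compact sets with two close points *)

(** Every set that is Hausdorff-close to [K] has points near a given point
    of [K]. *)
Lemma open_meets (R : realType) (X V : set R) : open V ->
  open [set K : compacts X | (K : set R) `&` V !=set0].
Proof.
move=> oV; rewrite openE => K [x [Kx Vx]].
have /nbhs_ballP[e /= e0 eV] : nbhs x V by exact: open_nbhs_nbhs.
apply/nbhs_ballP; exists e => //= L; rewrite ballEmdist /= => KL.
have [y Ly xy] := hausdorff_dist_lt
  (@compact_carrier_compact _ _ K) (@compact_carrier_neq0 _ _ L) KL Kx.
by exists y; split => //; exact: eV.
Qed.

(** The bound on [q - p] involves the dividing point [m] rather than points of [K], so
    that, for fixed [p], [m] and [q], the condition on [K] is only that it meets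
    two open intervals. *)
Definition close_pair {R : realType} (X : set R) (c : R) : set (compacts X) :=
  [set K | exists p m q : R, [/\ 0 < p, p < m, q - p <= c * m ^+ 2,
     (K : set R) `&` `]p, m[ !=set0 & (K : set R) `&` `]m, q[ !=set0]].

Lemma open_close_pair (R : realType) (X : set R) (c : R) :
  open (close_pair X c).
Proof.
rewrite openE => K [p [m [q [p0 pm qp Kpm Kmq]]]].
have oV := open_meets R X.
have near_meets (V : set R) : open V -> (K : set R) `&` V !=set0 ->
    nbhs K [set L : compacts X | (L : set R) `&` V !=set0].
  by move=> /oV {}oV KV; exact: open_nbhs_nbhs.
apply: filterS (filterI (near_meets _ (itv_open _ _) Kpm)
                        (near_meets _ (itv_open _ _) Kmq)) => L [Lpm Lmq].
by exists p, m, q.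
Qed.

Lemma close_pairP (R : realType) (X : set R) (c : R) (K : compacts X) :
  0 < c -> close_pair X c K ->
  exists x y, [/\ (K : set R) x, (K : set R) y, x < y & y - x <= c * y ^+ 2].
Proof.
move=> c0 [p [m [q [p0 pm qp [x [Kx xpm]] [y [Ky ymq]]]]]].
move: xpm ymq; rewrite /= !in_itv /= => /andP[px xm] /andP[my yq].
exists x, y; split => //; first exact: lt_trans my.
have : m ^+ 2 <= y ^+ 2 by rewrite lerXn2r ?nnegrE; lra.
by move=> /(ler_wpM2l (ltW c0)); lra.
Qed.

Definition compacts_add2 {R : realType} {X : set R} (K : compacts X) (x y : R)
    (Xx : X x) (Xy : X y) : compacts X.
Proof.
apply: (@Compacts R X ((K : set R) `|` ([set x] `|` [set y]))).
- move=> z [/compact_carrier_sub//|[->//|->//]].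
- by exists x; right; left.
- apply: compactU; first exact: compact_carrier_compact.
  by apply: compactU; exact: compact_set1.
Defined.

Lemma dense_close_pair (R : realType) (c : R) : 0 < c ->
  dense (close_pair (`[0, 1] : set R) c).
Proof.
move=> c0 O [K OK] oO.
have /nbhs_ballP[e /= e0 eO] : nbhs K O by exact: open_nbhs_nbhs.
have [k Kk] := @compact_carrier_neq0 _ _ K.
have /andP[k0 k1] : 0 <= k <= 1.
  by move: (compact_carrier_sub Kk); rewrite /= in_itv.
pose h := Num.min 1 (e / 2).
have h0 : 0 < h by rewrite lt_min ltr01 divr_gt0.
have h1 : h <= 1 by rewrite ge_min lexx.
have he : h <= e / 2 by rewrite ge_min lexx orbT.
(* Contracting [0, 1] about 1 / 2 sends k to a point m near k, with room h / 2
   on both sides. *)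
pose m := (1 - h) * k + h / 2.
have hk0 : 0 <= (1 - h) * k by rewrite mulr_ge0 // subr_ge0.
have hk1 : (1 - h) * k <= 1 - h by rewrite ler_piMr // subr_ge0.
have hkk0 : 0 <= h * k by rewrite mulr_ge0 // ltW.
have hkk1 : h * k <= h by rewrite ler_piMr // ltW.
have m0 : 0 < m by rewrite /m; lra.
pose s := Num.min (h / 4) (c * m ^+ 2 / 2).
have s0 : 0 < s by rewrite lt_min !divr_gt0 // mulr_gt0 // exprn_gt0.
have sh : s <= h / 4 by rewrite ge_min lexx.
have sc : s <= c * m ^+ 2 / 2 by rewrite ge_min lexx orbT.
have Xx : `[0, 1]%classic (m - s / 2).
  by rewrite /= in_itv /= /m; apply/andP; split; lra.
have Xy : `[0, 1]%classic (m + s / 2).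
  by rewrite /= in_itv /= /m; apply/andP; split; lra.
exists (compacts_add2 K (m - s / 2) (m + s / 2) Xx Xy); split.
(* |m - k| <= h / 2 <= e / 4 and s / 2 <= h / 8, so the new points are at a
   distance below 3 / 4 * e of k. *)
- apply: eO; rewrite ballEmdist /=; apply: (@le_lt_trans _ _ (3 / 4 * e)); last lra.
  apply: hausdorff_dist_le; [exact: compact_carrier_neq0|exact: compact_carrier_neq0| |].
  + by move=> z Kz; exists z; [left|rewrite subrr normr0; lra].
  + move=> z [Kz|[->|->]].
    * by exists z => //; rewrite subrr normr0; lra.
    * by exists k => //; rewrite ler_distl /m; apply/andP; split; lra.
    * by exists k => //; rewrite ler_distl /m; apply/andP; split; lra.
- exists (m - s), m, (m + s); split; [rewrite /m; lra|lra|lra| |].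
  + exists (m - s / 2); split; first by right; left.
    by rewrite /= in_itv /=; apply/andP; split; lra.
  + exists (m + s / 2); split; first by right; right.
    by rewrite /= in_itv /=; apply/andP; split; lra.
Qed.

(** * Typicality *)

(** The exceptional set is itself nowhere dense: its closure misses [U]. *)
Lemma typical_of_open_dense (T : topologicalType) (P : T -> Prop) (U : set T) :
  open U -> dense U -> U `<=` P -> typical P.
Proof.
move=> oU dU UP; exists (fun=> [set x | ~ P x]); split; last first.
  by rewrite bigcup_const //; exists 0%N.
move=> _; have clU : closure [set x | ~ P x] `<=` ~` U.
  rewrite [~` U](closure_id _).1; last exact: open_closedC.
  by apply: closure_subset => x nPx /UP.
apply/eqP/negPn/negP => /set0P ne.
have [x [ix Ux]] := dU _ ne (open_interior _).
exact: clU (interior_subset ix) Ux.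
Qed.

Lemma finite_set_nat_bounded (S : set nat) : finite_set S ->
  exists N, forall i, (N <= i)%N -> ~ S i.
Proof.
move=> fS; exists (\max_(i <- finmap.enum_fset (fset_set S)) i).+1 => i + Si.
apply/negP; rewrite -leqNgt.
by apply: (@leq_bigmax_seq _ _ xpredT id) => //; have := in_fset_set fS i; rewrite mem_set.
Qed.

Theorem theorem6p1 (R : realType) (a : nat -> R)
  (a_cvg : forall x : R, 0 <= x <= 1 ->
     cvgn [normed series (fun i => a i * x ^+ i)])
  (a_ratio : exists2 eps : R, 0 < eps &
     finite_set [set i : nat | ~ (eps < `|a i.+1| / `|a i|)]) :
  typical (fun K : compacts (`[0, 1] : set R) =>
    (power_series_image a K : set R)° !=set0).
Proof.
have [eps eps0 /finite_set_nat_bounded[N aN]] := a_ratio.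
have acvg : cvgn [normed series a].
  have := a_cvg 1; rewrite ler01 lexx => /(_ isT).
  by under eq_fun do rewrite expr1n mulr1.
have c0 : 0 < eps / 2 by rewrite divr_gt0.
apply: (typical_of_open_dense _ _ (close_pair `[0, 1] (eps / 2))).
- exact: open_close_pair.
- exact: dense_close_pair.
- move=> K /(close_pairP _ _ _ _ c0)[x [y [Kx Ky xy close]]].
  apply: (power_series_image_interior R a eps N K x y) => // i /aN.
  exact: contra_notP.
Qed.
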